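(* Let $K$ be a positive braid knot, i.e. a knot in $S^3$ which is the closure of a braid word in the standard generators $\sigma_1,\ldots,\sigma_{p-1}$ of the braid group on $p$ strands involving only positive powers of the generators. Then the first Khovanov homology group of $K$ vanishes: $\mathcal{H}^1(K)=0$ (in every quantum grading).
   Context: $\mathcal{H}^{i,j}(K)$ denotes Khovanov homology (with $\mathbb{Z}$ coefficients) of $K$, the categorification of the Jones polynomial: for a diagram $D$ with $m$ ordered crossings, one forms the cube of resolutions, assigns to each complete resolution $D_\epsilon$, $\epsilon\in\{0,1\}^m$, the tensor product of copies of $V=\mathbb{Z}\langle 1,X\rangle$ ($\deg 1=1$, $\deg X=-1$) over its circles, sets $C^i(D)=\bigoplus_{|\epsilon|=i}M_\epsilon\{i\}$, with differential the signed sum of edge maps given by the multiplication $m(1\otimes1)=1$, $m(1\otimes X)=m(X\otimes 1)=X$, $m(X\otimes X)=0$ and comultiplication $\Delta(1)=1\otimes X+X\otimes 1$, $\Delta(X)=X\otimes X$; the invariant complex is $C(D)[-n_-]\{n_+-2n_-\}$, where $n_\pm$ are the numbers of positive/negative crossings, and $\mathcal{H}^i(K)$ is its homology in homological degree $i$. With these conventions a diagram with only positive crossings has no homological shift. *)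

(* Defs.v *)
From HB Require Import structures.
From mathcomp Require Import all_boot all_order all_algebra.
Set Implicit Arguments. Unset Strict Implicit. Unset Printing Implicit Defensive.
Import GRing.Theory Num.Theory.
Local Open Scope ring_scope.

(* Braid group on q.+1 strands (strands 0..q); a positive braid word is a
   sequence w of generators, the entry i : 'I_q standing for sigma_(i+1),
   which crosses strands i and i+1.  Crossing number k (0 <= k < size w)
   sits between levels k and k+1; level (size w) is glued back to level 0
   (braid closure).  Diagram points: (level, strand). *)
Definition node (q : nat) (w : seq 'I_q) := ('I_(size w).+1 * 'I_q.+1)%type.

Definition gen (q : nat) (w : seq 'I_q) (k : nat) : nat :=
  nth 0%N [seq val i | i <- w] k.

(* Arcs of the complete resolution e (e k = false: 0-smoothing = oriented
   smoothing of the positive crossing; e k = true: 1-smoothing). *)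
Definition res_adj0 q (w : seq 'I_q) (e : {ffun 'I_(size w) -> bool})
    (a b : node w) : bool :=
  let ka := val a.1 in let ja := val a.2 in
  let kb := val b.1 in let jb := val b.2 in
  [&& ka == size w, kb == 0%N & ja == jb]
  || [exists k : 'I_(size w),
       let i := gen w k in
       [|| [&& ka == k, kb == k.+1, ja == jb & ((ja != i) && (ja != i.+1)) || ~~ e k],
           [&& e k, ka == k, kb == k, ja == i & jb == i.+1]
         | [&& e k, ka == k.+1, kb == k.+1, ja == i & jb == i.+1]]].

Definition res_adj q (w : seq 'I_q) (e : {ffun 'I_(size w) -> bool}) : rel (node w) :=
  fun a b => res_adj0 e a b || res_adj0 e b a.

Definition link_adj0 q (w : seq 'I_q) (a b : node w) : bool :=
  let ka := val a.1 in let ja := val a.2 in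
  let kb := val b.1 in let jb := val b.2 in
  [&& ka == size w, kb == 0%N & ja == jb]
  || [exists k : 'I_(size w),
       let i := gen w k in
       [&& ka == k, kb == k.+1 &
         [|| [&& ja == jb, ja != i & ja != i.+1],
             (ja == i) && (jb == i.+1)
           | (ja == i.+1) && (jb == i)]]].

Definition link_adj q (w : seq 'I_q) : rel (node w) :=
  fun a b => link_adj0 a b || link_adj0 b a.

Definition closure_is_knot q (w : seq 'I_q) : Prop :=
  forall a b : node w, connect (@link_adj q w) a b.

(* Enhanced states: a resolution e and a labelling of the points of the
   diagram by 1 (false) / X (true), constant on circles.  These are the
   standard Z-basis elements of M_e = V^{tensor circles}. *)
Definition state q (w : seq 'I_q) :=
  ({ffun 'I_(size w) -> bool} * {ffun node w -> bool})%type.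

Definition valid q (w : seq 'I_q) (s : state w) : bool :=
  [forall a, forall b, connect (res_adj s.1) a b ==> (s.2 a == s.2 b)].

(* Coefficient of basis element s' in the edge map (merge m / split Delta)
   at crossing k applied to basis element s. *)
Definition edge_coef q (w : seq 'I_q) (k : 'I_(size w)) (s s' : state w) : int :=
  let i := gen w k in
  let a : node w := (inord k, inord i) in
  let b : node w := (inord k, inord i.+1) in
  let c : node w := (inord k.+1, inord i) in
  let f := s.2 in let f' := s'.2 in
  let off := [forall n, (~~ connect (res_adj s.1) a n && ~~ connect (res_adj s.1) b n)
                        ==> (f n == f' n)] in
  if connect (res_adj s.1) a b then
    (* split: circle of a splits into circle of a and circle of c *)
    (if off && (if f a then f' a && f' c else f' a != f' c) then 1 else 0)
  else
    (* merge: circles of a and b merge *)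
    (if [&& off, f' a == (f a || f b) & ~~ (f a && f b)] then 1 else 0).

Definition kh_coef q (w : seq 'I_q) (k : 'I_(size w)) (s s' : state w) : int :=
  if [&& valid s, valid s', ~~ s.1 k, s'.1 k
       & [forall l, (l != k) ==> (s.1 l == s'.1 l)]]
  then (-1) ^+ #|[set l : 'I_(size w) | (l < k)%N && s.1 l]| * edge_coef k s s'
  else 0.

Definition kh_d q (w : seq 'I_q) (c : state w -> int) : state w -> int :=
  fun s' => \sum_(s : state w) \sum_(k : 'I_(size w)) c s * kh_coef k s s'.

(* c lies in C^i: supported on valid enhanced states of height i.  Since all
   crossings are positive, n_- = 0 and there is no homological shift. *)
Definition inC q (w : seq 'I_q) (i : nat) (c : state w -> int) : Prop :=
  forall s, c s != 0 -> valid s /\ #|[set l | s.1 l]| = i.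

(* Main.v *)
(* Write R = Z[X_0, ..., X_q] / (X_0^2, ..., X_q^2).  The all-0 resolution
   consists of the q+1 closed strands, so C^0 = R, and smoothing one crossing of
   sigma_(i+1) merges two strands, so it contributes R / (X_i - X_(i+1)) to C^1.
   Two crossings on the same pair of strands form a split, and injectivity of
   the comultiplication forces a 1-cycle to take the same value c_i at both.
   Two crossings on different pairs give c_i = c_j modulo
   (X_i - X_(i+1), X_j - X_(j+1)).  A common lift b of all the c_i is built by
   increasing i: to correct b at j, lift the defect d at j to the representative
   not involving X_(j+1).  This section of R -> R / (X_j - X_(j+1)) is a ring
   map fixing X_i - X_(i+1) for i < j, hence the lift of d still vanishes modulo
   these elements and the earlier values are kept. *)
Require Import Defs.
From mathcomp Require Import all_boot all_order all_algebra.
From mathcomp Require Import zify.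
Local Open Scope ring_scope.
Set Implicit Arguments. Unset Strict Implicit. Unset Printing Implicit Defensive.
Import GRing.Theory.

(** * Labellings of the strands *)

Section Merging.
Variable V : zmodType.
Implicit Types (F : (nat -> bool) -> V) (h : nat -> bool).

(* A function F of labellings h (h x = true for X, false for 1) is an element of
   R, given by its coefficients; [clr P h] relabels by 1 the strands in P. *)
Definition clr (P : pred nat) h : nat -> bool := fun x => h x && ~~ P x.

Definition fuse (i x : nat) : nat := if x == i.+1 then i else x.

(** The circle through strand x once strands i and i+1 are merged. *)
Definition fuse_class (i x : nat) : pred nat := fun y => fuse i x == fuse i y.

(** Labellings live on all of [nat]; this condition confines F to X_0, ..., X_q and also supplies
    extensionality in the labelling. *)
Definition depends_upto (q : nat) F : Prop :=
  forall h h', (forall x, (x <= q)%N -> h x = h' x) -> F h = F h'.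

(* The coefficient of the merge map V (x) V -> V at h, where P and Q are the
   two circles being merged and v is the common label: X comes from X (x) 1 and
   1 (x) X, hence the two ways of clearing a circle. *)
Definition push (P Q : pred nat) (v : bool) F h : V :=
  if v then F (clr P h) + F (clr Q h) else F h.

Definition merge_at (i : nat) F h : V := push (pred1 i) (pred1 i.+1) (h i) F h.

(* Merging the strands j and j+1 once i and i+1 are already merged. *)
Definition merge_over (i j : nat) F h : V :=
  push (fuse_class i j) (fuse_class i j.+1) (h j) F h.

Ltac clr_ext := let y := fresh in intro y; rewrite /clr /fuse_class /fuse /=;
  repeat (case: ifP => ? ); lia.

(** Both sides are the projection from R to its quotient by X_i - X_(i+1) and X_j - X_(j+1). *)
Lemma merge_overC q F i j h : depends_upto q F -> i != j ->
  h i = h i.+1 -> h j = h j.+1 ->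
  merge_over i j (merge_at i F) h = merge_over j i (merge_at j F) h.
Proof.
move=> Fq; wlog ij : i j / (i < j)%N.
  move=> H nij hi hj; case: (ltngtP i j) => [lt|gt|e]; first exact: H.
    by rewrite -H // eq_sym.
  by rewrite e eqxx in nij.
move=> _ hi hj.
have ext u v : u =1 v -> F u = F v by move=> uv; apply: Fq => x _.
have fji x : (x <= j)%N -> fuse j x = x by rewrite /fuse; case: eqP => //; lia.
have clrE P x : clr P h x = h x && ~~ P x by [].
have fi : fuse i i.+1 = i by rewrite /fuse eqxx.
have fij x : (x != i.+1) -> fuse i x = x by rewrite /fuse => /negPf->.
(* For adjacent pairs three strands become one circle; if it carries X, each side has three terms,
   one for each strand that keeps X. *)
case: (eqVneq j i.+1) => [ej|nj].
  subst j; rewrite /merge_over /merge_at /push !clrE /fuse_class !fji // fi !fij; try lia.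
  rewrite -hi; case: (h i) => //=.
  have [-> ->] : (i.+2 != i) /\ (i != i.+1) by split; lia.
  rewrite !eqxx /=.
  by rewrite -addrA; do 2?apply: (congr2 +%R); apply: ext; clr_ext.
rewrite /merge_over /merge_at /push !clrE /fuse_class !fij ?fji; try lia.
have [-> ->] : (j != i) /\ (j.+1 != i) by split; lia.
have [-> ->] : (i != j) /\ (i.+1 != j) by split; lia.
rewrite !andbT; case: (h i); case: (h j) => //.
  by rewrite addrACA; do 2!apply: (congr2 +%R); apply: ext; clr_ext.
all: by apply: (congr2 +%R); apply: ext; clr_ext.
Qed.

Lemma compatible_lift q (G : pred nat) (C : nat -> (nat -> bool) -> V) :
  (forall i, depends_upto q (C i)) ->
  (forall i j h, G i -> G j -> i != j -> (i < q)%N -> (j < q)%N ->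
     h i = h i.+1 -> h j = h j.+1 ->
     merge_over i j (C i) h = merge_over j i (C j) h) ->
  exists2 B, depends_upto q B &
    forall i h, G i -> (i < q)%N -> h i = h i.+1 -> merge_at i B h = C i h.
Proof.
move=> Cq compat.
suff H n : (n <= q)%N -> exists2 B, depends_upto q B &
    forall i h, G i -> (i < n)%N -> h i = h i.+1 -> merge_at i B h = C i h.
  exact: H.
elim: n => [|j IH] jq; first by exists (fun=> 0).
have [B Bq BC] := IH (ltnW jq).
case: (boolP (G j)) => Gj; last first.
  exists B => // i h Gi; rewrite ltnS leq_eqVlt => /orP[/eqP ij|ij]; last exact: BC.
  by rewrite ij (negPf Gj) in Gi.
(* [D] has meaning only where strands j and j+1 carry the same label, which [dup] enforces. *)
pose D h := C j h - merge_at j B h.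
pose dup h : nat -> bool := fun x => h (fuse j x).
(* [E] is the lift of the defect [D] that does not involve X_(j+1). *)
pose E h := if h j.+1 then 0 else D (dup h).
have mergeq i F : (i < q)%N -> depends_upto q F -> depends_upto q (merge_at i F).
  move=> iq Fq h h' hh; rewrite /merge_at /push hh ?(ltnW iq) //.
  by case: ifP => _; first apply: (congr2 +%R); apply: Fq => x xq; rewrite /clr ?hh.
have Dq : depends_upto q D.
  by move=> h h' hh; rewrite /D (Cq j _ _ hh) (mergeq j B jq Bq _ _ hh).
have dupq h h' : (forall x, (x <= q)%N -> h x = h' x) ->
    forall x, (x <= q)%N -> dup h x = dup h' x.
  by move=> hh x xq; apply: hh; rewrite /fuse; case: eqP; lia.
have Eq : depends_upto q E.
  by move=> h h' hh; rewrite /E hh // (Dq _ _ (dupq _ _ hh)).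
exists (fun h => B h + E h) => [h h' hh|i h Gi]; first by rewrite (Bq _ _ hh) (Eq _ _ hh).
have mergeD : merge_at i (fun h => B h + E h) h = merge_at i B h + merge_at i E h.
  by rewrite /merge_at /push; case: ifP => // _; rewrite addrACA.
rewrite ltnS leq_eqVlt mergeD => /orP[/eqP ij hi|ij hi].
  subst i; suff -> : merge_at j E h = D h by rewrite addrC subrK.
  have hf x : h (fuse j x) = h x by rewrite /fuse; case: eqP => // ->.
  have dupE g : (forall x, g (fuse j x) = h x) -> D (dup g) = D h.
    by move=> gh; apply: Dq => x _; rewrite /dup gh.
  have clrl : clr (pred1 j) h j.+1 = h j by rewrite /clr hi /= gtn_eqF //= andbT.
  have clrr : clr (pred1 j.+1) h j.+1 = false by rewrite /clr /= eqxx andbF.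
  (* If strand j carries X, only the term clearing j+1 survives, because [E] vanishes when j+1
     carries X. *)
  rewrite /merge_at /push /E clrl clrr -hi; case hj: (h j) => /=; last by rewrite dupE.
  have jS x : fuse j x != j.+1 by rewrite /fuse; case: (x =P j.+1); lia.
  by rewrite add0r; apply: dupE => x; rewrite /clr hf /= jS andbT.
rewrite BC //; suff -> : merge_at i E h = 0 by rewrite addr0.
(* The defect dies in the double quotient: there [C j] agrees with [C i] by compatibility, and so
   does B by induction. *)
have D0 g : g i = g i.+1 -> g j = g j.+1 -> merge_over j i D g = 0.
  move=> gi gj.
  have -> : merge_over j i D g = merge_over j i (C j) g - merge_over j i (merge_at j B) g.
    rewrite /merge_over /push /D; case: ifP => // _.
    by rewrite opprD addrACA.
  have nij : i != j by lia.
  rewrite -(compat i j) //; last by lia.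
  rewrite -(@merge_overC q) //; apply/eqP; rewrite subr_eq0; apply/eqP.
  rewrite /merge_over /push; case: ifP => _; last by rewrite BC.
  have fii : fuse i i.+1 = fuse i i by rewrite /fuse eqxx; case: eqP; lia.
  by apply: (congr2 +%R); rewrite BC // /clr /fuse_class fii gi.
have [fi fiS] : fuse j i = i /\ fuse j i.+1 = i.+1.
  by rewrite /fuse !ifF //; apply/eqP; lia.
have fj : fuse j j = fuse j j.+1 by rewrite /fuse eqxx; case: eqP.
(* For x = i or i+1, clearing strand x of h amounts to clearing its whole [fuse j] class in
   [dup h]. *)
have := D0 (dup h); rewrite {1 2 3 4}/dup fi fiS fj => /(_ hi erefl).
rewrite /merge_at /merge_over /push {1}/dup /fuse_class fi fiS /E.
have clrj x : (x <= j)%N -> clr (pred1 x) h j.+1 = h j.+1.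
  by move=> xj; rewrite /clr /= gtn_eqF ?andbT.
rewrite !clrj ?(ltnW ij) //; case: (h j.+1); case: (h i); rewrite ?addr0 //.
by move=> <-; apply: (congr2 +%R); apply: Dq => x _; rewrite /dup /clr /= eq_sym.
Qed.
End Merging.

(** * Resolutions with few 1-smoothings *)

Section Resolutions.
Variables (q : nat) (w : seq 'I_q).
Implicit Types (e : {ffun 'I_(size w) -> bool}) (f : {ffun node w -> bool}).
Implicit Types (k l : 'I_(size w)) (h : nat -> bool) (c : state w -> int).

Definition col h : {ffun node w -> bool} := [ffun n => h (val n.2)].

Definition vertex (t j : nat) : node w := (inord t, inord j).

(** The three corners are the points [a], [b] and [c] of [edge_coef]. *)
Definition corner k : node w := vertex k (gen w k).
Definition corner_right k : node w := vertex k (gen w k).+1.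
Definition corner_up k : node w := vertex k.+1 (gen w k).

Lemma gen_lt k : (gen w k < q)%N.
Proof. by rewrite /gen (nth_map (tnth (in_tuple w) k)) ?ltn_ord. Qed.

Lemma res_adj_sym e : symmetric (res_adj e).
Proof. by move=> a b; rewrite /res_adj orbC. Qed.

Lemma res_connectC e : connect_sym (res_adj e).
Proof. exact/sym_connect_sym/res_adj_sym. Qed.

Lemma connect_invariant (T : eqType) e (g : node w -> T) a b :
  (forall a b, res_adj0 e a b -> g a = g b) ->
  connect (res_adj e) a b -> g a = g b.
Proof.
move=> ge /connectP[p]; elim: p a => [|x p IH] a /=; first by move=> _ ->.
by case/andP=> /orP[/ge ->|/ge <-] /IH{}IH /IH.
Qed.

Lemma valid_invariant e f :
  (forall a b, res_adj0 e a b -> f a = f b) -> valid (e, f).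
Proof.
move=> fe; apply/forallP=> a; apply/forallP=> b; apply/implyP=> /= ab.
exact/eqP/(connect_invariant fe).
Qed.

Lemma validP e f a b : valid (e, f) -> connect (res_adj e) a b -> f a = f b.
Proof. by move=> /forallP/(_ a)/forallP/(_ b)/implyP H /H/eqP. Qed.

Lemma res_adj0_col (T : eqType) e (h : nat -> T) a b :
  (forall k, e k -> h (gen w k) = h (gen w k).+1) ->
  res_adj0 e a b -> h (val a.2) = h (val b.2).
Proof.
move=> he /orP[/and3P[_ _ /eqP->//]|/existsP[k] /=].
case/or3P=> [/and4P[_ _ /eqP->//]|/and5P[ek _ _ /eqP-> /eqP->]|/and5P[ek _ _ /eqP-> /eqP->]];
  exact: he.
Qed.

Lemma valid_col e h :
  (forall k, e k -> h (gen w k) = h (gen w k).+1) -> valid (e, col h).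
Proof.
move=> he; apply: valid_invariant => a b ab; rewrite !ffunE.
exact: res_adj0_col he ab.
Qed.

Lemma connect_levels e j t1 t2 : (t1 <= t2)%N -> (t2 <= size w)%N ->
  (forall k, (t1 <= k < t2)%N -> ~~ e k) ->
  connect (res_adj e) (inord t1, j) (inord t2, j).
Proof.
elim: t2 => [|t IH]; first by rewrite leqn0 => /eqP->.
rewrite leq_eqVlt => /orP[/eqP->//|t1t] tw ek.
apply: (@connect_trans _ _ (inord t, j)).
  by apply: IH => [||k /andP[k1 k2]]; [lia|lia|apply: ek; lia].
apply/connect1/orP; left; apply/orP; right; apply/existsP.
exists (Ordinal tw); rewrite /= !inordK //; last by lia.
rewrite !eqxx /=; have -> : ~~ e (Ordinal tw) by apply: ek => /=; lia.
by rewrite orbT.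
Qed.

Lemma connect_wrap e j : connect (res_adj e) (inord (size w), j) (inord 0, j).
Proof. by apply/connect1/orP; left; rewrite /res_adj0 /= !inordK // !eqxx. Qed.

(* A column cut at one level stays connected through the braid closure. *)
Lemma connect_column e (t : 'I_(size w).+1) j :
  (forall k l, e k -> e l -> k = l) ->
  connect (res_adj e) (t, j) (inord 0, j).
Proof.
move=> e1; rewrite -[t]inord_val.
(* If the only 1-smoothing lies below level t, go up and around the closure; otherwise go straight
   down. *)
case: (boolP [exists k, e k && (k < t)%N]) => [/existsP[k /andP[ek kt]]|].
  apply: connect_trans (connect_wrap e j).
  apply: connect_levels => [||l /andP[tl _]] //; first by rewrite -ltnS ltn_ord.
  by apply/negP=> /(e1 _ _ ek) kl; rewrite kl in kt; lia.
rewrite negb_exists => /forallP ek; rewrite res_connectC.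
apply: connect_levels => // [|l /andP[_ lt]]; first by rewrite -ltnS ltn_ord.
by have := ek l; rewrite lt andbT.
Qed.

Definition single k : {ffun 'I_(size w) -> bool} := [ffun l => l == k].

Definition none : {ffun 'I_(size w) -> bool} := [ffun=> false].

Lemma connect_none a b :
  connect (res_adj none) a b = (val a.2 == val b.2).
Proof.
apply/idP/eqP=> [|ab].
  apply: (connect_invariant (g := fun n : node w => val n.2)) => {}a {}b.
  by apply: (res_adj0_col (h := id)) => k; rewrite ffunE.
case: a b ab => [t j] [t' j'] /= /val_inj <-.
have e1 k l : none k -> none l -> k = l by rewrite !ffunE.
by apply: connect_trans (connect_column t j e1) _; rewrite res_connectC connect_column.
Qed.

Lemma connect_cap e k : e k ->
  connect (res_adj e) (corner k) (corner_right k).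
Proof.
move=> ek; apply/connect1/orP; left; apply/orP; right; apply/existsP; exists k.
have := gen_lt k; have := ltn_ord k => kw kq.
by rewrite /= !inordK ?eqxx ?ek ?orbT //; lia.
Qed.

Lemma connect_single k a b :
  connect (res_adj (single k)) a b =
  (fuse (gen w k) (val a.2) == fuse (gen w k) (val b.2)).
Proof.
have kq := gen_lt k.
apply/idP/eqP=> [|ab].
  apply: (connect_invariant (g := fun n : node w => fuse (gen w k) (val n.2))) => {}a {}b.
  apply: res_adj0_col => l; rewrite ffunE => /eqP->.
  by rewrite /fuse eqxx; case: eqP; lia.
have e1 x y : single k x -> single k y -> x = y by rewrite !ffunE => /eqP-> /eqP->.
have ek : single k k by rewrite ffunE.
(* Each point is joined to a representative of its class at level 0; strand i+1 reaches strand i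
   through the cap at crossing k. *)
have main (t : 'I_(size w).+1) (j : 'I_q.+1) :
    connect (res_adj (single k)) (t, j) (inord 0, inord (fuse (gen w k) j)).
  apply: connect_trans (connect_column t j e1) _.
  rewrite /fuse; case: eqP => [jE|_]; last by rewrite inord_val.
  rewrite -[j]inord_val jE res_connectC.
  apply: connect_trans (connect_column (inord k) _ e1).
  rewrite res_connectC.
  apply: connect_trans (connect_column (inord k) _ e1).
  by rewrite res_connectC; apply: connect_cap.
case: a b ab => [t j] [t' j'] /= ab.
by apply: connect_trans (main t j) _; rewrite ab res_connectC.
Qed.

(** * Edge maps of the cube *)

Definition del k e : {ffun 'I_(size w) -> bool} := [ffun l => e l && (l != k)].

Definition sgn e k : int := (-1) ^+ #|[set l : 'I_(size w) | (l < k)%N && e l]|.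

Definition edge_sum c e' f' k : int :=
  \sum_f c (del k e', f) * kh_coef k (del k e', f) (e', f').

(** An edge into e' at crossing k can only start at [del k e']. *)
Lemma kh_dE c e' f' : kh_d c (e', f') = \sum_(k | e' k) edge_sum c e' f' k.
Proof.
rewrite /kh_d exchange_big /= [RHS]big_mkcond /=; apply: eq_bigr => k _.
pose H e f := c (e, f) * kh_coef k (e, f) (e', f').
have -> : \sum_s c s * kh_coef k s (e', f') = \sum_e \sum_f H e f.
  by rewrite pair_bigA /=; apply: eq_bigr => -[].
case: ifP => e'k; last first.
  by rewrite big1 // => e _; rewrite big1 // => f _; rewrite /H /kh_coef /= e'k !andbF mulr0.
rewrite (bigD1 (del k e')) //= [X in _ + X]big1 ?addr0 // => e ne.
rewrite big1 // => f _; rewrite /H /kh_coef /=; case: ifP; last by rewrite mulr0.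
case/and5P=> _ _ ek _ /forallP el; case/negP: ne; apply/eqP/ffunP=> l.
rewrite ffunE; have := el l; case: eqVneq => [->|_ /eqP->]; last by rewrite andbT.
by rewrite (negPf ek) andbF.
Qed.

Lemma kh_coef_del e' f f' k : e' k -> valid (e', f') ->
  kh_coef k (del k e', f) (e', f') =
  if valid (del k e', f) then
    sgn e' k * edge_coef k (del k e', f) (e', f') else 0.
Proof.
move=> e'k v'; rewrite /kh_coef /= v' e'k !ffunE eqxx andbF /=.
have -> : [forall l, (l != k) ==> (del k e' l == e' l)].
  by apply/forallP=> l; apply/implyP=> lk; rewrite ffunE lk andbT.
rewrite andbT; case: ifP => // _; congr (_ ^+ _ * _).
by apply: eq_card => l; rewrite !inE ffunE -val_eqE /=; case: ltngtP; rewrite /= ?andbT ?andbF.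
Qed.

(** Delta(1) and Delta(X) have disjoint supports, so f is the only labelling whose split contains
    f'. This is the injectivity of the comultiplication. *)
Lemma edge_sum_split c e e' f f' k :
  e' k -> del k e' = e -> connect (res_adj e) (corner k) (corner_right k) ->
  valid (e, f) -> valid (e', f') ->
  (forall n, ~~ connect (res_adj e) (corner k) n -> f n = f' n) ->
  (if f (corner k) then f' (corner k) && f' (corner_up k)
   else f' (corner k) != f' (corner_up k)) ->
  edge_sum c e' f' k = sgn e' k * c (e, f).
Proof.
rewrite /corner_right /corner_up; set a := corner k; set b := vertex _ _; set d := vertex _ _.
move=> e'k eE ab v v' off fa; rewrite /edge_sum eE.
have coef g : kh_coef k (e, g) (e', f') = sgn e' k *+ (g == f).
  rewrite -{1}eE kh_coef_del // eE; case: ifP => vg; last first.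
    by case: eqP vg => // ->; rewrite v.
  rewrite /edge_coef /= -/a -/b -/d ab.
  case: (eqVneq g f) => [->|ng]; last first.
    case: ifP => //; rewrite ?mulr0 // => /andP[/forallP offg ga].
    case/eqP: ng; apply/ffunP=> n; case: (boolP (connect (res_adj e) a n)) => an.
      rewrite -(validP vg an) -(validP v an).
      by move: fa ga; do 2!case: ifP; case: (f' a); case: (f' d).
    have := offg n; rewrite off // an /=.
    have -> : ~~ connect (res_adj e) b n.
      by apply: contra an; apply: connect_trans.
    by move=> /eqP.
  rewrite fa andbT ifT ?mulr1 //; apply/forallP=> n; apply/implyP=> /andP[an _].
  by apply/eqP/off.
rewrite (bigD1 f) //= coef eqxx mulr1n big1 ?addr0 1?mulrC // => g /negPf gf.
by rewrite coef gf mulr0.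
Qed.

Definition circle_clr e a f : {ffun node w -> bool} :=
  [ffun n => f n && ~~ connect (res_adj e) a n].

(** The label 1 arises only from 1 (x) 1, and X from X (x) 1 and 1 (x) X. Since f' gives both
    circles the common label, clearing one of them produces these two sources. *)
Lemma edge_sum_merge c e e' f' k :
  e' k -> del k e' = e -> ~~ connect (res_adj e) (corner k) (corner_right k) ->
  valid (e, f') -> valid (e', f') ->
  edge_sum c e' f' k = sgn e' k *
   (if f' (corner k)
    then c (e, circle_clr e (corner k) f') + c (e, circle_clr e (corner_right k) f')
    else c (e, f')).
Proof.
set a := corner k; set b := corner_right k => e'k eE nab v v'.
have f'b : f' b = f' a by rewrite (validP v' (connect_cap e'k)).
have vclr x : valid (e, circle_clr e x f').
  apply/forallP=> y; apply/forallP=> z; apply/implyP=> /= yz.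
  by rewrite !ffunE (validP v yz) (same_connect_r (@res_connectC e) yz).
have coef g : kh_coef k (e, g) (e', f') = sgn e' k *+
    (if f' a then (g == circle_clr e a f') || (g == circle_clr e b f') else g == f').
  rewrite -{1}eE kh_coef_del // eE; case: ifP => vg; last first.
    case: ifP => _; case: eqP => [gE|_]; rewrite -?gE ?vg // ?orbF; first by rewrite gE vclr in vg.
      by case: eqP => // gE; rewrite gE vclr in vg.
    by rewrite gE v in vg.
  rewrite /edge_coef /= -/a -/b (negPf nab).
  set m := [&& _, _ & _]; suff -> : m = if f' a
      then (g == circle_clr e a f') || (g == circle_clr e b f') else g == f'.
    by case: (if f' a then _ else _); rewrite ?mulr1 ?mulr0.
  apply/idP/idP=> [/and3P[/forallP off /eqP f'a ng]|].
    have gE f : f a = g a -> f b = g b -> valid (e, f) ->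
        (forall n, ~~ connect (res_adj e) a n -> ~~ connect (res_adj e) b n -> f n = f' n) ->
        g = f.
      move=> fa fb vf fo; apply/ffunP=> n.
      case: (boolP (connect (res_adj e) a n)) => [an|na].
        by rewrite -(validP vg an) -(validP vf an).
      case: (boolP (connect (res_adj e) b n)) => [bn|nb].
        by rewrite -(validP vg bn) -(validP vf bn).
      by rewrite fo //; have := off n; rewrite na nb => /eqP.
    case: ifP => f'aE.
      rewrite f'aE in f'a f'b; move: f'a ng; case ga: (g a); case gb: (g b) => // _ _; apply/orP.
        right; apply/eqP/gE=> [||//|n _ nb]; rewrite ffunE ?connect0 ?andbF ?nb ?andbT //.
        by rewrite res_connectC nab f'aE ga.
      left; apply/eqP/gE=> [||//|n na _]; rewrite ffunE ?connect0 ?andbF ?na ?andbT //.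
      by rewrite nab f'b gb.
    move: f'a; rewrite f'aE; case ga: (g a); case gb: (g b) => // _.
    by apply/eqP/gE => //; rewrite ?f'b f'aE ?ga ?gb.
  case: ifP => f'a; last first.
    move=> /eqP gE; rewrite /m gE f'b f'a eqxx !andbT.
    by apply/forallP=> n; rewrite eqxx implybT.
  rewrite f'a in f'b.
  case/orP=> /eqP gE; rewrite /m gE !ffunE !connect0 ?nab 1?(res_connectC e b a) ?nab f'a f'b !andbT;
    apply/forallP=> n; apply/implyP=> /andP[na nb]; by rewrite ffunE ?na ?nb andbT.
rewrite /edge_sum eE; case: ifP coef => f'a coef; last first.
  rewrite (bigD1 f') //= coef eqxx mulr1n big1 ?addr0 1?mulrC // => g /negPf gf.
  by rewrite coef gf mulr0.
have ab : circle_clr e b f' != circle_clr e a f'.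
  apply/eqP=> /ffunP/(_ a); rewrite !ffunE connect0 f'a andbF.
  by rewrite res_connectC nab.
rewrite (bigD1 (circle_clr e a f')) //= (bigD1 (circle_clr e b f')) //= !coef !eqxx orbT.
rewrite !mulr1n mulrDr big1 ?addr0 1?[c _ * _]mulrC 1?[c (e, circle_clr e b f') * _]mulrC //.
by move=> g /andP[/negPf ga /negPf gb]; rewrite coef ga gb mulr0.
Qed.

Lemma sgn_single k : sgn (single k) k = 1.
Proof.
rewrite /sgn (_ : [set _ | _] = set0) ?cards0 //.
by apply/setP=> l; rewrite !inE ffunE -val_eqE /=; lia.
Qed.

Lemma del_single k : del k (single k) = none.
Proof. by apply/ffunP=> l; rewrite !ffunE andbN. Qed.

(** * Cycle equations at height two *)

Definition both k l : {ffun 'I_(size w) -> bool} := [ffun x => (x == k) || (x == l)].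

(** The edges into [both k l] have signs +1 and -1, so the cycle equation reads x - y = 0. *)
Lemma cycle_pair c k l f' x y : (k < l)%N -> kh_d c (both k l, f') = 0 ->
  edge_sum c (both k l) f' k = sgn (both k l) k * x ->
  edge_sum c (both k l) f' l = sgn (both k l) l * y -> x = y.
Proof.
move=> kl; have lk : l != k by rewrite -val_eqE /=; lia.
rewrite kh_dE (bigD1 k) ?ffunE ?eqxx //= (bigD1 l) ?ffunE ?eqxx ?orbT //= big1 => [|z]; last first.
  by rewrite ffunE; case: (z == k); case: (z == l).
move=> + xE yE; rewrite {}xE {}yE addr0.
have -> : sgn (both k l) k = 1.
  rewrite /sgn (_ : [set _ | _] = set0) ?cards0 //.
  by apply/setP=> z; rewrite !inE ffunE -!val_eqE /=; lia.
have -> : sgn (both k l) l = -1.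
  rewrite /sgn (_ : [set _ | _] = [set k]) ?cards1 //.
  by apply/setP=> z; rewrite !inE ffunE -!val_eqE /=; lia.
by rewrite mul1r mulN1r => /eqP; rewrite subr_eq0 => /eqP.
Qed.

Lemma del_bothl k l : k != l -> del k (both k l) = single l.
Proof.
by move=> kl; apply/ffunP=> x; rewrite !ffunE; case: eqVneq => [->|_]; rewrite ?(negPf kl) ?andbT.
Qed.

Lemma del_bothr k l : k != l -> del l (both k l) = single k.
Proof.
move=> kl; apply/ffunP=> x; rewrite !ffunE.
by case: (eqVneq x l) => [->|_]; rewrite ?andbF ?andbT ?orbF // eq_sym (negPf kl).
Qed.

Lemma corner_strand k : val (corner k).2 = gen w k.
Proof. by rewrite /= inordK // ltnS ltnW ?gen_lt. Qed.

Lemma corner_level k : val (corner k).1 = k.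
Proof. by rewrite /= inordK // ltnS ltnW. Qed.

Lemma corner_up_level k : val (corner_up k).1 = k.+1.
Proof. by rewrite /= inordK // ltnS. Qed.

Lemma corner_right_strand k : val (corner_right k).2 = (gen w k).+1.
Proof. by rewrite /= inordK // ltnS gen_lt. Qed.

Lemma circle_clr_none a h :
  circle_clr none a (col h) = col (clr (pred1 (val a.2)) h).
Proof. by apply/ffunP=> n; rewrite !ffunE connect_none eq_sym. Qed.

Lemma circle_clr_single k a h :
  circle_clr (single k) a (col h) = col (clr (fuse_class (gen w k) (val a.2)) h).
Proof. by apply/ffunP=> n; rewrite !ffunE connect_single. Qed.

Lemma edge_sum_single c k h : let i := gen w k in h i = h i.+1 ->
  edge_sum c (single k) (col h) k = merge_at i (fun g => c (none, col g)) h.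
Proof.
move=> i hi; have kq : (i < q)%N := gen_lt k.
have v : valid (single k, col h) by apply: valid_col => l; rewrite ffunE => /eqP->.
have v0 : valid (none, col h) by apply: valid_col => l; rewrite ffunE.
have ek : single k k by rewrite ffunE.
rewrite (@edge_sum_merge c none) ?del_single // ?sgn_single ?mul1r.
  by rewrite !circle_clr_none ffunE corner_strand corner_right_strand.
by rewrite connect_none corner_strand corner_right_strand neq_ltn ltnSn.
Qed.

Lemma edge_sum_over c e k l h : let i := gen w k in let j := gen w l in
  i != j -> h i = h i.+1 -> h j = h j.+1 -> e l -> del l e = single k ->
  edge_sum c e (col h) l = sgn e l * merge_over i j (fun g => c (single k, col g)) h.
Proof.
move=> i j nij hi hj el elk; have iq : (i < q)%N := gen_lt k; have jq : (j < q)%N := gen_lt l.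
have e1 x : e x -> x = k \/ x = l.
  move=> ex; case: (eqVneq x l) => [->|xl]; [by right|left].
  by have := congr1 (fun f : {ffun _ -> _} => f x) elk; rewrite !ffunE ex xl => /esym/eqP.
have v : valid (e, col h) by apply: valid_col => x /e1[]->.
have v1 : valid (single k, col h) by apply: valid_col => x; rewrite ffunE => /eqP->.
rewrite (edge_sum_merge _ el elk) //.
  by rewrite !circle_clr_single ffunE corner_strand corner_right_strand.
rewrite connect_single corner_strand corner_right_strand -/i -/j /fuse.
by do 2!case: ifP => ?; lia.
Qed.

(** As i and j differ, both edges into [both k l] are merges. *)
Lemma cycle_compatible c k l h : let i := gen w k in let j := gen w l in
  (forall s, kh_d c s = 0) -> i != j -> h i = h i.+1 -> h j = h j.+1 ->
  merge_over i j (fun g => c (single k, col g)) h =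
  merge_over j i (fun g => c (single l, col g)) h.
Proof.
move=> i j c0; wlog kl : k l @i @j / (k < l)%N.
  move=> H nij hi hj; case: (ltngtP k l) => [lt|gt|e]; first exact: H.
    by rewrite -H // eq_sym.
  by rewrite /i /j (val_inj e) eqxx in nij.
move=> nij hi hj; have nkl : k != l by rewrite -val_eqE /=; lia.
apply/esym/(cycle_pair kl (c0 (both k l, col h))).
  by apply: edge_sum_over; rewrite 1?eq_sym ?del_bothl // ffunE eqxx.
by apply: edge_sum_over; rewrite ?del_bothr // ffunE eqxx orbT.
Qed.

Lemma cycle_same_gen c k l h : let i := gen w k in
  (forall s, kh_d c s = 0) -> gen w l = i -> h i = h i.+1 ->
  c (single k, col h) = c (single l, col h).
Proof.
move=> i c0; wlog kl : k l @i / (k < l)%N.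
  move=> H li hi; case: (ltngtP k l) => [lt|gt|e]; first exact: H.
    by rewrite -(H l k) ?li.
  by rewrite (val_inj e).
move=> li hi; have nkl : k != l by rewrite -val_eqE /=; lia.
have lw := ltn_ord l.
(* In the double smoothing, the strands i and i+1 between levels k+1 and l form
   the inner circle; labelling it X makes the preimage under the split unique. *)
pose f' : {ffun node w -> bool} :=
  [ffun n => h (val n.2) || [&& fuse i (val n.2) == i, (k < val n.1)%N & (val n.1 <= l)%N]].
have v' : valid (both k l, f').
  apply: valid_invariant => a b.
  rewrite /res_adj0 !ffunE; case/orP=> [/and3P[/eqP-> /eqP-> /eqP->]|].
    by rewrite [(size w <= l)%N]leqNgt lw !andbF.
  case/existsP=> x /= xab.
  have eE : both k l x -> gen w x = i by rewrite ffunE => /orP[]/eqP->.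
  have cap : fuse i i = fuse i i.+1 by rewrite /fuse eqxx; case: eqP.
  case/or3P: xab => [/and4P[/eqP-> /eqP-> /eqP-> nx]| |].
  2,3: by case/and5P=> /eE-> /eqP-> /eqP-> /eqP-> /eqP->; rewrite -hi -cap.
  congr (_ || _); case: eqP => //= fb.
  have bi : (val b.2 == i) || (val b.2 == i.+1).
    by move: fb; rewrite /fuse /=; case: ifP => [_ _|_ ->]; rewrite ?orbT ?eqxx.
  (* On strands i and i+1, membership in the inner circle can change only across k or l, where the
     1-smoothing removes the vertical arcs. *)
  have xk : x != k.
    by apply: contraTN nx => /eqP->; rewrite !ffunE eqxx /= orbF -/i negb_and !negbK.
  have xl : x != l.
    by apply: contraTN nx => /eqP->; rewrite !ffunE eqxx orbT /= orbF li negb_and !negbK.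
  by move: xk xl; rewrite -!val_eqE /=; lia.
have vs (x : 'I_(size w)) : gen w x = i -> valid (single x, col h).
  by move=> xi; apply: valid_col => y; rewrite ffunE => /eqP->; rewrite xi.
have fii : fuse i i = i by rewrite /fuse; case: ifP => // /eqP; lia.
have off (x y : 'I_(size w)) n : gen w x = i -> gen w y = i ->
    ~~ connect (res_adj (single x)) (corner y) n -> (col h) n = f' n.
  move=> xi yi; rewrite connect_single corner_strand xi yi fii !ffunE eq_sym.
  by move=> /negPf->; rewrite orbF.
have cap (x y : 'I_(size w)) : gen w x = i -> gen w y = i ->
    connect (res_adj (single x)) (corner y) (corner_right y).
  move=> xi yi; rewrite connect_single corner_strand corner_right_strand xi yi.
  by rewrite fii /fuse eqxx.
apply/esym/(cycle_pair kl (c0 (both k l, f'))).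
  apply: (@edge_sum_split c (single l)); rewrite ?ffunE ?eqxx ?del_bothl ?vs ?cap //.
    by move=> n; apply: off.
  (* At k the upper corner lies on the inner circle and the lower one outside; at l it is the
     reverse. *)
  rewrite corner_up_level corner_level !corner_strand ltnn ltnSn kl fii eqxx.
  by rewrite andbF orbF orbT; case: (h _).
apply: (@edge_sum_split c (single k)); rewrite ?ffunE ?eqxx ?orbT ?del_bothr ?vs ?cap //.
  by move=> n; apply: off.
rewrite corner_up_level corner_level !corner_strand li ltnn leqnn kl fii eqxx.
by rewrite !andbF orbF orbT; case: (h _).
Qed.

(** * Construction of the bounding chain *)

Lemma col_eq h h' : (forall x, (x <= q)%N -> h x = h' x) -> col h = col h'.
Proof. by move=> hh; apply/ffunP=> n; rewrite !ffunE hh // -ltnS ltn_ord. Qed.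

(** Reading level 0 loses nothing on valid states with at most one 1-smoothing, where each strand is
    connected to its level 0 point. *)
Definition strand_label f : nat -> bool := fun j => f (ord0, inord j).

Lemma strand_labelK h x : (x <= q)%N -> strand_label (col h) x = h x.
Proof. by move=> xq; rewrite /strand_label ffunE /= inordK. Qed.

Lemma col_strand_label k f : valid (single k, f) -> f = col (strand_label f).
Proof.
move=> v; apply/ffunP=> -[t j]; rewrite ffunE /strand_label /= inord_val.
by apply: (validP v); rewrite connect_single.
Qed.

Lemma strand_label_fused k f : valid (single k, f) ->
  strand_label f (gen w k) = strand_label f (gen w k).+1.
Proof.
move=> v; have kq := gen_lt k; apply: (validP v).
by rewrite connect_single /= !inordK /fuse ?eqxx ?ltnS ?(ltnW kq) //; case: ifP.
Qed.

Lemma height1 e : #|[set l | e l]| = 1 -> exists k, e = single k.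
Proof.
move=> /eqP/cards1P[k ek]; exists k; apply/ffunP=> l.
by have /setP/(_ l) := ek; rewrite !inE ffunE.
Qed.

Lemma positive_braid_H1 c : inC 1 c -> (forall s, kh_d c s = 0) ->
  exists b : state w -> int, inC 0 b /\ (forall s, kh_d b s = c s).
Proof.
move=> c1 c0.
pose G i := [exists k : 'I_(size w), gen w k == i].
(* The choice of crossing is harmless by [cycle_same_gen] when strands i and i+1 agree; the default
   0 is never reached for i in [G]. *)
pose C i h := if [pick k : 'I_(size w) | gen w k == i] is Some k then c (single k, col h) else 0.
have CE (k : 'I_(size w)) h : h (gen w k) = h (gen w k).+1 -> C (gen w k) h = c (single k, col h).
  move=> hk; rewrite /C; case: pickP => [l /eqP lk|/(_ k)]; last by rewrite eqxx.
  by apply: cycle_same_gen => //; rewrite lk.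
case: (@compatible_lift int q G C) => [i h h' hh|i j h|B Bq BC].
- by rewrite /C; case: pickP => // k _; rewrite (col_eq hh).
- rewrite /C => Gi Gj nij _ _ hi hj.
  case: pickP => [k /eqP ki|H]; last by case/existsP: Gi => k; rewrite H.
  case: pickP => [l /eqP lj|H]; last by case/existsP: Gj => l; rewrite H.
  by subst i j; apply: cycle_compatible.
pose b (s : state w) := if (s.1 == none) && valid s then B (strand_label s.2) else 0.
have b0 : inC 0 b.
  move=> s; rewrite /b; case: ifP => [/andP[/eqP s0 ->] _|]; last by rewrite eqxx.
  by split=> //; rewrite s0 (_ : [set _ | _] = set0) ?cards0 //; apply/setP=> l; rewrite !inE ffunE.
exists b; split=> // -[e f].
have [v|nv] := boolP (valid (e, f)); last first.
  have -> : c (e, f) = 0 by apply/eqP; apply: contraNT nv => /c1[].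
  by rewrite /kh_d big1 // => s _; rewrite big1 // => k _; rewrite /kh_coef (negPf nv) andbF mulr0.
(* Away from height 1 both sides vanish: [b] lives on [none], so its boundary meets only resolutions
   with exactly one 1-smoothing. *)
have [/height1[k ek]|ne] := eqVneq #|[set l | e l]| 1; last first.
  have -> : c (e, f) = 0 by apply/eqP; apply: contraNT ne => /c1[_ /= ->].
  rewrite kh_dE big1 // => k ek; rewrite /edge_sum big1 // => g _.
  rewrite /b /=; case: ifP => [/andP[/eqP eN _]|]; last by rewrite mul0r.
  case/negP: ne; apply/cards1P; exists k; apply/setP=> l; rewrite !inE.
  have := congr1 (fun e : {ffun _ -> _} => e l) eN; rewrite !ffunE.
  by case: eqVneq => [->|_]; rewrite ?andbT.
subst e; set h := strand_label f; have fE : f = col h := col_strand_label v.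
have hk : h (gen w k) = h (gen w k).+1 := strand_label_fused v.
rewrite kh_dE (bigD1 k) ?ffunE //= big1 => [|l]; last by rewrite ffunE => /andP[->].
rewrite addr0 fE edge_sum_single // -CE // -BC ?gen_lt //; last by apply/existsP; exists k.
have bE g : b (none, col g) = B g.
  rewrite /b /= eqxx valid_col => [|l]; last by rewrite ffunE.
  exact/Bq/strand_labelK.
by rewrite /merge_at /push !bE.
Qed.
End Resolutions.

(* H^1 of the closure of a positive braid word on q.+1 strands vanishes:
   every 1-cycle is a boundary of a 0-chain (all quantum gradings at once). *)
Theorem theorem2 (q : nat) (w : seq 'I_q) :
  closure_is_knot w ->
  forall c : state w -> int,
    inC 1 c -> (forall s, kh_d c s = 0) ->
    exists b : state w -> int, inC 0 b /\ (forall s, kh_d b s = c s).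
Proof. by move=> _ c; apply: positive_braid_H1. Qed.
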